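(* Let $\widehat\theta_T$ be an estimator of $\theta$ based on $X_{(T)}$ and let $S=S(T)$ satisfy $S(T)\le T$ for all $T$ and $S(T)\sim T$ as $T\to\infty$. Assume that for all $\theta\in\Theta$: 1. $T^2\,\mathrm E_\theta\|\widehat\theta_T-\widehat\theta_S\|_{\mathbb R^d}^4=\mathcal O(1)$ as $T\to\infty$; 2. there is a measurable function $\ell:E\to\mathbb R_+$ (not depending on the parameters) such that for all $\theta,\theta^*\in\Theta$, $\|r(X_T,\theta^* )-r(X_T,\theta)\|_{\mathbb R^k}\le \ell(X_T)\,\|\theta^*-\theta\|_{\mathbb R^d}$; 3. there is $\nu>0$ such that $\sup_T\mathrm E_\theta\big(\ell^{4+\nu}(X_T)\big)<\infty$; 4. there is $m\in(2,\infty]$ such that $\sup_{T}\|\Delta r\|_{\mathrm L^m((\Delta f)\lambda)}<\infty$ and $\bar\beta(S,T)=o\big(T^{-m/(m-2)}\big)$ as $T\to\infty$ (exponent $-1$ if $m=\infty$); 5. $\lim_{T\to\infty}T\,\mathrm E_\theta\|\widehat\theta_T-\widehat\theta_S\|_{\mathbb R^d}^2=0$; 6. the limits $\lim_{T\to\infty}T\rho_T^S(\theta)$ and $\lim_{T\to\infty}T\rho_T(\theta)$ exist and are equal to a common matrix $R(\theta)\in\mathbb R^{k\times k}$. Then $\lim_{T\to\infty}TR_T(\theta)=\lim_{T\to\infty}T\rho_T(\theta)$ for all $\theta\in\Theta$.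
   Context: Setting. $(X_t,\ t\ge0)$ (time set $\mathbb N$ or $\mathbb R_+$) is a random process with values in a measurable space $(E,\mathcal B)$, with distribution $\mathrm P_\theta$, $\theta\in\Theta\subset\mathbb R^d$. $X_{(T)}=(X_t,\ 0\le t\le T)$. $(Y_t)$ is an $\mathbb R^k$-valued process, and $r(x,\theta)=\mathrm E_\theta(Y_T\mid X_T=x)\in\mathbb R^k$ is assumed not to depend on $T$, is measurable in $(x,\theta)$ and differentiable in $\theta$ on $\Theta$, with Jacobian $\mathrm J_\theta r(x,\theta)$. $\mu_\theta$ is the distribution of $X_T$ under $\mathrm P_\theta$, assumed not to depend on $T$; $r(\cdot,\theta)$ and $\mathrm J_\theta r(\cdot,\theta)$ are in $\mathrm L^2(\mu_\theta)$. Risks ($A^{\times2}=AA'$, $S=S(T)$; $\widehat\theta_S$ is the estimator based on $X_{(S)}$): $\rho_T(\theta)=\int_E\mathrm E_\theta(r(x,\widehat\theta_T)-r(x,\theta))^{\times2}d\mu_\theta(x)$, $R_T(\theta)=\mathrm E_\theta(r(X_T,\widehat\theta_T)-r(X_T,\theta))^{\times2}$, $\rho_T^S(\theta)=\int_E\mathrm E_\theta(r(x,\widehat\theta_S)-r(x,\theta))^{\times2}d\mu_\theta(x)$. Dependence. $\mathcal X_S$ is the space of paths of $X_{(S)}$ with the $\sigma$-field generated by the coordinate maps, and $\bar\theta_S:\mathcal X_S\to\Theta$ is the map with $\bar\theta_S(X_{(S)})=\widehat\theta_S$. Put $\Delta r(x,\xi)=r(x,\bar\theta_S(\xi))-r(x,\theta)$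 for $x\in E$, $\xi\in\mathcal X_S$. The law of $(X_T,X_{(S)})$ under $\mathrm P_\theta$ is assumed dominated by a $\sigma$-finite measure $\lambda$ on $E\times\mathcal X_S$, with joint density $f_{\theta,(X_T,X_{(S)})}$; $f_{\theta,X_T}$ and $f_{\theta,X_{(S)}}$ are the densities of $X_T$ and $X_{(S)}$, so that $f_{\theta,X_T}(x)f_{\theta,X_{(S)}}(\xi)$ is the $\lambda$-density of the product of the laws of $X_T$ and $X_{(S)}$. Put $\Delta f(x,\xi)=|f_{\theta,(X_T,X_{(S)})}(x,\xi)-f_{\theta,X_T}(x)f_{\theta,X_{(S)}}(\xi)|$ and $\bar\beta(S,T)=\int_{E\times\mathcal X_S}\Delta f\,d\lambda$. $\mathrm L^m((\Delta f)\lambda)$ is the $\mathrm L^m$ space of the measure with $\lambda$-density $\Delta f$. ($\Delta r,\Delta f$ depend on $T$ and $\theta$.) *)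

(* Defs.v *)
From HB Require Import structures.
From mathcomp Require Import all_boot all_order all_algebra.
From mathcomp Require Import all_classical all_reals all_analysis measurable_realfun.

Set Implicit Arguments.
Unset Strict Implicit.
Unset Printing Implicit Defensive.

Import Order.TTheory GRing.Theory Num.Theory.
Import numFieldNormedType.Exports.

Local Open Scope classical_set_scope.
Local Open Scope ring_scope.

(** Vectors of R^d are column vectors; the library norm on matrices is the
    sup norm, hence the explicit Euclidean norm. *)
Definition enorm (R : realType) n (v : 'cV[R]_n) : R :=
  Num.sqrt (\sum_i v i 0 ^+ 2).

Definition square_tr (R : realType) n (v : 'cV[R]_n) : 'M[R]_n := v *m v^T.

Definition borel_cV (R : realType) (n : nat) :=
  g_sigma_algebraType (@open 'cV[R]_n).

(** [f] restricted to [D] is measurable for the trace sigma-algebra on [D].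
    Unlike [measurable_fun D f], this is not vacuous when [D] is not
    measurable. *)
Definition trace_measurable_fun {dT dU} {T : measurableType dT}
    {U : measurableType dU} (D : set T) (f : T -> U) :=
  forall B, measurable B ->
    exists2 A, measurable A & D `&` f @^-1` B = D `&` A.

(** [J] is the Jacobian matrix at [a] of the restriction of [f] to [D]. On
    interior points of [D] this is Frechet differentiability of [f] at [a];
    the values of [f] outside [D] never matter. *)
Definition is_jacobian_on (R : realType) m n (D : set 'cV[R]_m)
    (f : 'cV[R]_m -> 'cV[R]_n) (a : 'cV[R]_m) (J : 'M[R]_(n, m)) :=
  enorm (f b - f a - J *m (b - a)) / enorm (b - a) @[b --> within D a^'] --> 0.

Definition is_time_set (R : realType) (time : set R) :=
  time = range (fun n : nat => n%:R) \/ time = [set t | 0 <= t].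

Definition time_oo (R : realType) (time : set R) : set_system R :=
  within time (pinfty_nbhs R).

Section paths.
Context {R : realType} (time : set R) {dE} (E : measurableType dE) (S : R).

Definition path_fun := {t : R | time t /\ t <= S} -> E.

Definition path_cylinders : set (set path_fun) :=
  [set C | exists t, exists2 B, measurable B & C = [set xi | B (xi t)]].

Definition path_space := g_sigma_algebraType path_cylinders.

End paths.

Section observed_path.
Context {R : realType} {time : set R} {dO dE} {Omega : measurableType dO}
  {E : measurableType dE}.
Variables (X : R -> {mfun Omega >-> E}) (S : R).

Definition observed_path : Omega -> path_space time E S :=
  fun w t => X (sval t) w.

Lemma measurable_observed_path : measurable_fun [set: Omega] observed_path.
Proof.
apply: (@measurability _ _ Omega (path_space time E S) setT observed_path
  (@path_cylinders R time dE E S)) => //.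
move=> _ [_ [t [B mB ->]] <-]; rewrite setTI.
by rewrite -[X in measurable X]setTI; exact: (measurable_funPT (X (sval t))).
Qed.

HB.instance Definition _ := @isMeasurableFun.Build _ _ _ _ observed_path
  measurable_observed_path.

End observed_path.
Arguments observed_path {R} time {dO dE Omega E} X S.

(** [g] is a version of [x |-> E(Y | X = x)], coordinatewise. *)
Definition is_regression_function (R : realType) {dO dE}
    (Omega : measurableType dO) (E : measurableType dE) k
    (P : probability Omega R) (X : {mfun Omega >-> E})
    (Y : Omega -> 'cV[R]_k) (g : E -> 'cV[R]_k) :=
  forall i : 'I_k,
    [/\ P.-integrable [set: Omega] (fun w => (Y w i 0)%:E),
        (distribution P X).-integrable [set: E] (fun x => (g x i 0)%:E) &
        forall A, measurable A ->
          (\int[P]_(w in X @^-1` A) (Y w i 0)%:E =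
           \int[distribution P X]_(x in A) (g x i 0)%:E)%E].

(** Risks have entries in [\bar R]: the library integral is total, and a
    divergent or undefined entry is infinite. Hence convergence to a real
    matrix forces the entries to be genuine finite integrals for large [T]. *)
Section risks.
Context {R : realType} {dO dE} {Omega : measurableType dO}
  {E : measurableType dE} {d k : nat}.
Implicit Types (P : probability Omega R) (mu : probability E R)
  (r : E -> 'cV[R]_d -> 'cV[R]_k) (est : Omega -> 'cV[R]_d)
  (theta : 'cV[R]_d).

Definition expectation_mx n P (A : Omega -> 'M[R]_n) : 'M[\bar R]_n :=
  \matrix_(i, j) 'E_P[fun w => A w i j]%E.

Definition risk P (XT : Omega -> E) r est theta : 'M[\bar R]_k :=
  expectation_mx P
    (fun w => square_tr (r (XT w) (est w) - r (XT w) theta)).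

Definition risk_indep P mu r est theta : 'M[\bar R]_k :=
  \matrix_(i, j) (\int[mu]_x
    expectation_mx P (fun w => square_tr (r x (est w) - r x theta)) i j)%E.

End risks.

Definition scaled_cvg (R : realType) n (time : set R) (M : R -> 'M[\bar R]_n)
    (L : 'M[R]_n) :=
  map_mx (fun y => T%:E * y)%E (M T) @[T --> time_oo time] --> map_mx EFin L.

Definition is_density {dT} (T : measurableType dT) (R : realType)
    (nu : set T -> \bar R) (lambda : {measure set T -> \bar R}) (f : T -> R) :=
  (forall x, 0 <= f x) /\
  forall A, measurable A -> nu A = (\int[lambda]_(x in A) (f x)%:E)%E.

Section measure_of_density.
Context {dT} {T : measurableType dT} {R : realType}.
Variables (lambda : {measure set T -> \bar R}) (f : T -> R).
Hypotheses (mf : measurable_fun [set: T] f) (f0 : forall x, 0 <= f x).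
Local Open Scope ereal_scope.

Definition density_measure of measurable_fun [set: T] f &
    (forall x, 0 <= f x)%R := fun A : set T => \int[lambda]_(x in A) (f x)%:E.

Let nu := density_measure mf f0.

Let nu0 : nu set0 = 0.
Proof. by rewrite /nu /density_measure integral_set0. Qed.

Let nu_ge0 A : 0 <= nu A.
Proof. by apply: integral_ge0 => x _; rewrite lee_fin. Qed.

Let nu_sigma_additive : semi_sigma_additive nu.
Proof.
apply: semi_sigma_additive_nng_induced => [|x]; last by rewrite lee_fin.
exact/measurable_EFinP.
Qed.

HB.instance Definition _ := isMeasure.Build _ _ _ (density_measure mf f0)
  nu0 nu_ge0 nu_sigma_additive.

End measure_of_density.

Section dependence.
Context {R : realType} {d1 d2} {T1 : measurableType d1}
  {T2 : measurableType d2}.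
Variables (f : {mfun (T1 * T2)%type >-> R}) (f1 : {mfun T1 >-> R})
  (f2 : {mfun T2 >-> R}).

Definition Delta_f (p : T1 * T2) : R := `|f p - f1 p.1 * f2 p.2|.

Lemma Delta_f_ge0 p : 0 <= Delta_f p. Proof. exact: normr_ge0. Qed.

Lemma measurable_Delta_f : measurable_fun [set: T1 * T2] Delta_f.
Proof.
apply: measurableT_comp => //; apply: measurable_funB => //.
by apply: measurable_funM; apply: measurableT_comp.
Qed.

Definition Delta_f_measure (lambda : {measure set (T1 * T2) -> \bar R}) :
    {measure set (T1 * T2) -> \bar R} :=
  density_measure lambda measurable_Delta_f Delta_f_ge0.

Definition beta_bar (lambda : {measure set (T1 * T2) -> \bar R}) : \bar R :=
  (\int[lambda]_p (Delta_f p)%:E)%E.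

End dependence.

Definition Delta_r (R : realType) {T1 T2 : Type} d k
    (r : T1 -> 'cV[R]_d -> 'cV[R]_k) (thetabar : T2 -> 'cV[R]_d)
    (theta : 'cV[R]_d) (p : T1 * T2) : 'cV[R]_k :=
  r p.1 (thetabar p.2) - r p.1 theta.

(** The exponent [m / (m - 2)], equal to [1] for [m = +oo]. *)
Definition mixing_exponent (R : realType) (m : \bar R) : R :=
  if m is p%:E then p / (p - 2) else 1.

(* Main.v *)
Require Import Defs.
From HB Require Import structures.
From mathcomp Require Import all_boot all_order all_algebra.
From mathcomp Require Import all_classical all_reals all_analysis.
From mathcomp Require Import measurable_realfun ess_sup_inf ring lra.

Set Implicit Arguments.
Unset Strict Implicit.
Unset Printing Implicit Defensive.

Import Order.TTheory GRing.Theory Num.Theory.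
Import numFieldNormedType.Exports.

Local Open Scope classical_set_scope.
Local Open Scope ring_scope.

(** Write [Z = D + W] with [D = r(X_T, thetahat_T) - r(X_T, thetahat_S)] and
    [W = r(X_T, thetahat_S) - r(X_T, theta)], so that
    [Z Z' - W W' = D W' + W D' + D D'].

    Since [thetahat_S] only depends on the path up to [S], the difference
    between [E(W W')] and [rho^S] is the integral of [Delta r (Delta r)']
    against the difference of the joint density and the product density,
    hence at most the integral of [|Delta r|^2 Delta f]. After multiplication
    by [T] it is negligible by Young's inequality with exponents [m / 2] and
    [m / (m - 2)], which splits it into the [L^m] bound and the mixing rate.

    By the Lipschitz bound [|D| <= ell(X_T) |thetahat_T - thetahat_S|].
    Splitting according to whether [ell(X_T)] is larger than a constant, the
    second and fourth moments of [thetahat_T - thetahat_S] and the [4 + nu]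
    moment of [ell(X_T)] give [T E|D|^2 -> 0]. As [T E|W|^2] is bounded, the
    cross terms are negligible as well. *)

(** * Integration against densities and image measures *)

Section ge0_integral_density_measure.
Import HBNNSimple.

(** Both sides are continuous along increasing sequences of nonnegative functions, so it suffices to
    treat the simple functions that approximate [g]. *)
Lemma ge0_integral_density_measure d (T : measurableType d) (R : realType)
    (lambda : {measure set T -> \bar R}) (f : T -> R)
    (mf : measurable_fun [set: T] f) (f0 : forall x, 0 <= f x)
    (g : T -> \bar R) :
  measurable_fun [set: T] g -> (forall x, 0 <= g x)%E ->
  (\int[density_measure lambda mf f0]_x g x =
   \int[lambda]_x (g x * (f x)%:E))%E.
Proof.
move=> mg g0.
have mEf : measurable_fun [set: T] (EFin \o f) by exact/measurable_EFinP.
pose h := nnsfun_approx measurableT mg.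
have ndh x : {homo (fun n => (h n x)%:E) : m n / (m <= n)%N >-> (m <= n)%E}.
  by move=> m n mn; rewrite lee_fin; exact/lefP/nd_nnsfun_approx.
have h0 n x : 0 <= h n x by exact: fun_ge0.
transitivity (limn (fun n =>
    \int[density_measure lambda mf f0]_x (h n x)%:E)%E).
  rewrite -monotone_convergence//.
  - apply: eq_integral => x _; apply/esym/cvg_lim => //.
    exact: cvg_nnsfun_approx.
  - by move=> n; exact/measurable_EFinP/measurable_funP.
  - by move=> n x _; rewrite lee_fin.
transitivity (limn (fun n => \int[lambda]_x ((h n x)%:E * (f x)%:E))%E);
  last first.
  rewrite -monotone_convergence//.
  - apply: eq_integral => x _; apply/cvg_lim => //.
    by apply: cvgeZr => //; exact: cvg_nnsfun_approx.
  - by move=> n; apply: emeasurable_funM => //; exact/measurable_EFinP.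
  - by move=> n x _; rewrite mule_ge0 ?lee_fin.
  - move=> x _ m n mn; rewrite lee_wpmul2r ?lee_fin//.
    exact/lefP/nd_nnsfun_approx.
congr (limn _); apply/funext => n.
rewrite integralT_nnsfun sintegralE.
have mA y : measurable (h n @^-1` [set y]) by [].
(* For a simple function the integral is a finite sum over its values; the mass of a level set is by
   definition the integral of [f] over it, that is, of its indicator times [f]. *)
transitivity (\sum_(y \in range (h n))
    \int[lambda]_x (y%:E * ((\1_(h n @^-1` [set y]) x)%:E * (f x)%:E)))%E.
  apply: eq_fsbigr => y; rewrite inE => -[x _ <-].
  rewrite ge0_integralZl_EFin//.
  - congr (_ * _)%E; rewrite /density_measure /= [LHS]integral_mkcond.
    apply: eq_integral => z _; rewrite patchE indicE.
    by case: ifPn => _; rewrite ?mul1e ?mul0e.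
  - by move=> z _; rewrite mule_ge0// lee_fin.
  - by apply: emeasurable_funM => //; exact/measurable_EFinP.
rewrite -ge0_integral_fsum//.
- apply: eq_integral => x _; rewrite [in RHS]fimfunE -fsumEFin//.
  rewrite ge0_mule_fsuml; last by move=> y; rewrite nnfun_muleindic_ge0.
  by apply: eq_fsbigr => y _; rewrite muleA.
- move=> y; apply: emeasurable_funM => //; apply: emeasurable_funM => //.
  exact/measurable_EFinP.
- move=> y x _; rewrite muleA mule_ge0 ?lee_fin//.
  exact: (nnfun_muleindic_ge0 (h n) y x).
Qed.

End ge0_integral_density_measure.

(** Multiplication by the nonnegative [f] commutes with taking positive and negative parts, so the
    nonnegative case applies to each part, whether or not [g] is integrable. *)
Lemma integral_density_measure d (T : measurableType d) (R : realType)
    (lambda : {measure set T -> \bar R}) (f : T -> R)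
    (mf : measurable_fun [set: T] f) (f0 : forall x, 0 <= f x)
    (g : T -> \bar R) :
  measurable_fun [set: T] g ->
  (\int[density_measure lambda mf f0]_x g x =
   \int[lambda]_x (g x * (f x)%:E))%E.
Proof.
move=> mg; rewrite [LHS]integralE [RHS]integralE.
rewrite !ge0_integral_density_measure//; last 2 first.
- exact: measurable_funeneg.
- exact: measurable_funepos.
congr (_ - _)%E; apply: eq_integral => x _.
  by rewrite !funeposE maxe_pMl ?lee_fin// mul0e.
by rewrite !funenegE maxe_pMl ?lee_fin// mul0e mulNe.
Qed.

Lemma integral_comp_pushforward d1 d2 (T1 : measurableType d1)
    (T2 : measurableType d2) (R : realType) (mu : {measure set T1 -> \bar R})
    (phi : T1 -> T2) (mphi : measurable_fun [set: T1] phi) (g : T2 -> \bar R) :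
  measurable_fun [set: T2] g ->
  (\int[mu]_x g (phi x) = \int[pushforward mu phi]_y g y)%E.
Proof.
move=> mg; rewrite [LHS]integralE [RHS]integralE.
congr (_ - _)%E; apply/esym.
  rewrite (ge0_integral_pushforward mphi)//; last exact: measurable_funepos.
  by rewrite preimage_setT; apply: eq_integral => x _; rewrite /= !funeposE.
rewrite (ge0_integral_pushforward mphi)//; last exact: measurable_funeneg.
by rewrite preimage_setT; apply: eq_integral => x _; rewrite /= !funenegE.
Qed.

Lemma integral_density d (T : measurableType d) (R : realType)
    (nu lambda : {measure set T -> \bar R}) (f : T -> R) (g : T -> \bar R) :
  measurable_fun [set: T] f -> is_density nu lambda f ->
  measurable_fun [set: T] g ->
  (\int[nu]_x g x = \int[lambda]_x (g x * (f x)%:E))%E.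
Proof.
move=> mf [f0 nuE] mg; rewrite -(integral_density_measure _ mf f0)//.
by apply: eq_measure_integral => A mA _; exact: nuE.
Qed.

(** Integrability passes from [v] to [u = (u - v) + v], so that the difference of the integrals is a
    genuine difference of real numbers and equals the integral of [u - v]. *)
Lemma abse_integralB_le d (T : measurableType d) (R : realType)
    (mu : {measure set T -> \bar R}) (u v : T -> R) (c : R) :
  measurable_fun [set: T] u -> mu.-integrable [set: T] (EFin \o v) ->
  (\int[mu]_x `|u x - v x|%:E <= c%:E)%E ->
  mu.-integrable [set: T] (EFin \o u) /\
  (`|\int[mu]_x (u x)%:E - \int[mu]_x (v x)%:E| <= c%:E)%E.
Proof.
move=> mu_ iv uvc.
have mv : measurable_fun [set: T] v.
  exact/measurable_EFinP/(measurable_int mu).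
have muv : measurable_fun [set: T] (fun x => u x - v x).
  exact: measurable_funB.
have iuv : mu.-integrable [set: T] (EFin \o (fun x => u x - v x)).
  apply/integrableP; split; first exact/measurable_EFinP.
  by rewrite (le_lt_trans uvc)// ltry.
have iu : mu.-integrable [set: T] (EFin \o u).
  have := integrableD measurableT iuv iv.
  by apply: eq_integrable => // x _ /=; rewrite -EFinD subrK.
split=> //; rewrite -integralB//.
apply: le_trans uvc; apply: (le_trans (le_abse_integral _ _ _)) => //.
by apply: emeasurable_funB; exact/measurable_EFinP.
Qed.

(** * Limits of matrices and of extended reals *)

(** The entries lie in an arbitrary topological space so that [\bar R] is covered. A basic
    neighbourhood of a matrix is a product of neighbourhoods of its finitely many entries, and a
    filter is stable under finite intersections. *)
Lemma cvg_mx_entryP {I : Type} {U : topologicalType} (F : set_system I)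
    {FF : Filter F} m n (M : I -> 'M[U]_(m, n)) (L : 'M[U]_(m, n)) :
  M x @[x --> F] --> L <-> forall i j, M x i j @[x --> F] --> L i j.
Proof.
split=> [ML i j A /= LA|ML A [Q LQ QA]].
  apply: (ML [set N | A (N i j)]).
  pose Q (i' : 'I_m) (j' : 'I_n) :=
    if (i' == i) && (j' == j) then A else [set: U].
  exists Q => [i' j'|N QN] /=.
    rewrite /Q; case: ifP => [/andP[/eqP-> /eqP->]//|_]; exact: filterT.
  by have := QN i j; rewrite /Q !eqxx.
have H : \forall x \near F, forall i j, Q i j (M x i j).
  have := @filter_forall I ('I_m * 'I_n)%type
    (fun ij x => Q ij.1 ij.2 (M x ij.1 ij.2)) F FF.
  move=> /(_ (fun ij => ML ij.1 ij.2 _ (LQ ij.1 ij.2))).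
  by apply: filterS => x H i j; exact: (H (i, j)).
by apply: filterS H => x H; exact: QA.
Qed.

(** A finite bound on the distance from [u] to the finite value [v] forces [u] to be finite; the
    rest is the triangle inequality in [R]. *)
Lemma cvg_approx_ereal {I : Type} {R : realType} (F : set_system I)
    {FF : Filter F} (u v : I -> \bar R) (l : R) :
  v x @[x --> F] --> l%:E ->
  (forall e : R, 0 < e -> \forall x \near F, (`|u x - v x| <= e%:E)%E) ->
  u x @[x --> F] --> l%:E.
Proof.
move=> /fine_cvgP[vfin vl] uv.
have fu x e : v x \is a fin_num -> (`|u x - v x| <= e%:E)%E ->
    u x \is a fin_num.
  by case: (v x) => // r _; case: (u x).
apply/fine_cvgP; split.
  by near=> x; apply: (fu x 1); near: x => //; exact: uv.
apply/cvgrPdist_le => e e0.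
have e2 : 0 < e / 2 by rewrite divr_gt0.
have h1 := uv _ e2.
have h2 := (cvgrPdist_le _ _).1 vl _ e2.
near=> x.
have : v x \is a fin_num by near: x.
have : (`|u x - v x| <= (e / 2)%:E)%E by near: x.
have : `|l - fine (v x)| <= e / 2 by near: x; exact: h2.
move=> /=; case: (v x) => // a; case: (u x) => // b /=.
rewrite lee_fin => la ba _.
by rewrite (splitr e) (le_trans (ler_distD a _ _))//= lerD// distrC.
Unshelve. all: by end_near. Qed.

Lemma cvge_near_le (I : Type) (R : realType) (F : set_system I)
    {FF : Filter F} (u : I -> \bar R) (l K : R) :
  u x @[x --> F] --> l%:E -> l < K -> \forall x \near F, (u x <= K%:E)%E.
Proof.
move=> /fine_cvgP[ufin ul] lK.
have uK := cvgr_le _ ul _ lK.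
apply: filterS2 ufin (uK _) => x /=.
by case: (u x) => //= a _; rewrite lee_fin.
Qed.

(** * Trading an [L^m] bound against the mixing rate *)

(** Young's inequality without the optimal constant. If [t] is at most [e * x^(m-2)], the first term
    dominates. Otherwise [x^(m-2) < t / e], hence [x^2] is at most [(t / e)^(2/(m-2))], and the
    second term dominates because [1 + 2/(m-2) = m/(m-2)]. *)
Lemma scaled_square_le (R : realType) (m e t x : R) :
  2 < m -> 0 < e -> 0 <= t -> 0 <= x ->
  t * x ^+ 2 <= e * x `^ m + t `^ (m / (m - 2)) * e^-1 `^ (2 / (m - 2)).
Proof.
move=> m2 e0 t0 x0.
have m20 : 0 < m - 2 by rewrite subr_gt0.
have [tx|xt] := leP t (e * x `^ (m - 2)).
  apply: (@le_trans _ _ (e * x `^ m)); last by rewrite lerDl mulr_ge0 ?powR_ge0.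
  apply: (le_trans (ler_wpM2r (sqr_ge0 x) tx)).
  rewrite -mulrA -powR_mulrn// -powRD ?subrK//.
  by rewrite gt_eqF// (lt_trans _ m2).
have tp : 0 < t by apply: le_lt_trans xt; rewrite mulr_ge0 ?powR_ge0// ltW.
apply: (@le_trans _ _ (t `^ (m / (m - 2)) * e^-1 `^ (2 / (m - 2)))); last first.
  by rewrite lerDr mulr_ge0 ?powR_ge0// ltW.
have -> : m / (m - 2) = 1 + 2 / (m - 2) by field; rewrite gt_eqF.
rewrite powRD; last by rewrite (gt_eqF tp) implybT.
rewrite powRr1// -mulrA ler_wpM2l//.
rewrite -powRM ?invr_ge0 ?(ltW e0) ?(ltW tp)//.
have -> : x ^+ 2 = (x `^ (m - 2)) `^ (2 / (m - 2)).
  by rewrite -powRrM mulrCA divff ?gt_eqF// mulr1 powR_mulrn.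
apply: ge0_ler_powR; rewrite ?nnegrE ?powR_ge0//.
- by rewrite divr_ge0// ltW.
- by rewrite mulr_ge0 ?invr_ge0// ltW.
by rewrite ler_pdivlMr// mulrC ltW.
Qed.

(** The constant [c] is fixed before the space, the measure and [t]: it will serve for all times at
    once, although the path space and [Delta_f] change with time. *)
Lemma scaled_square_integral_le (R : realType) (m : \bar R) (K e : R) :
  (2%:E < m)%E -> 0 <= K -> 0 < e ->
  exists2 c : R, 0 <= c &
    forall d (T : measurableType d) (mu : {measure set T -> \bar R})
      (g : T -> R) (t : R), 0 <= t ->
      measurable_fun [set: T] g -> (forall x, 0 <= g x) ->
      ('N[mu]_m[EFin \o g] <= K%:E)%E ->
      (t%:E * \int[mu]_x (g x ^+ 2)%:E <=
       e%:E + c%:E * ((t `^ mixing_exponent m)%:E * mu [set: T]))%E.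
Proof.
move=> m2 K0 e0; case: m m2 => [m| |]// m2; last first.
  exists (K ^+ 2); first exact: sqr_ge0.
  move=> d T mu g t t0 mg g0; rewrite unlock => gK.
  rewrite /mixing_exponent powRr1//.
  have gKae : {ae mu, forall x, [set: T] x -> ((g x ^+ 2)%:E <= (K ^+ 2)%:E)%E}.
    (* The norm gives an essential bound only if the total mass is positive; for mass zero an almost
       everywhere statement is trivial. *)
    have [mu0|] := ltP 0%E (mu [set: T]).
      rewrite mu0 in gK; move/ess_supP : gK; apply: filterS => x /= + _.
      by rewrite !lee_fin ger0_norm// => gK; rewrite lerXn2r ?nnegrE.
    move=> mu0; apply: ae_eq0 => //.
    by apply/eqP; rewrite eq_le mu0/=.
  have : (\int[mu]_x (g x ^+ 2)%:E <= (K ^+ 2)%:E * mu [set: T])%E.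
    rewrite -integral_cst//; apply: ae_ge0_le_integral => //.
    - by move=> x _; rewrite lee_fin sqr_ge0.
    - by apply/measurable_EFinP; exact: measurable_funX.
    - by move=> x _; rewrite lee_fin sqr_ge0.
  move=> /(lee_wpmul2l (x := t%:E)) => /(_ t0) /le_trans; apply.
  by rewrite muleCA leeDr// lee_fin ltW.
rewrite lte_fin in m2.
have m0 : 0 < m by rewrite (lt_trans _ m2).
(* Chosen so that [e' * K^m] is at most [e]; the added [1] covers [K = 0]. *)
pose e' := e / (K `^ m + 1).
have K1 : 0 < K `^ m + 1 by rewrite ltr_wpDl ?powR_ge0.
have e'0 : 0 < e' by rewrite divr_gt0.
exists (e'^-1 `^ (2 / (m - 2))); first exact: powR_ge0.
move=> d T mu g t t0 mg g0 gK.
have mgm : measurable_fun [set: T] (fun x => g x `^ m).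
  exact: (measurableT_comp (measurable_powR m)).
have : (\int[mu]_x (g x `^ m)%:E <= (K `^ m)%:E)%E.
  have -> : (\int[mu]_x (g x `^ m)%:E = 'N[mu]_m%:E[EFin \o g] `^ m)%E.
    rewrite poweR_Lnorm ?gt_eqF//; apply: eq_integral => x _ /=.
    by rewrite ger0_norm.
  rewrite -poweR_EFin; apply: gt0_ler_poweR => //; first exact: ltW.
  - by rewrite in_itv/= leey Lnorm_ge0.
  - by rewrite in_itv/= leey lee_fin K0.
move=> gm.
rewrite -ge0_integralZl_EFin//; last 2 first.
- by move=> x _; rewrite lee_fin sqr_ge0.
- by apply/measurable_EFinP; exact: measurable_funX.
set c := _ `^ (2 / (m - 2)).
apply: (@le_trans _ _ (\int[mu]_x
    (e'%:E * (g x `^ m)%:E + (t `^ (m / (m - 2)) * c)%:E))%E).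
  apply: ge0_le_integral => //.
  - by move=> x _; rewrite -EFinM lee_fin mulr_ge0// sqr_ge0.
  - apply/measurable_EFinP; apply: measurable_funM => //.
    exact: measurable_funX.
  - apply: emeasurable_funD => //; apply/measurable_EFinP.
    exact: measurable_funM.
  - move=> x _; rewrite -!EFinM -EFinD lee_fin; exact: scaled_square_le.
rewrite ge0_integralD//; last 3 first.
- by move=> x _; rewrite -EFinM lee_fin mulr_ge0 ?powR_ge0// ltW.
- by apply/measurable_EFinP; exact: measurable_funM.
- by move=> x _; rewrite lee_fin mulr_ge0 ?powR_ge0.
rewrite integral_cst//; apply: leeD; last first.
  by rewrite EFinM -muleA muleCA.
rewrite ge0_integralZl_EFin//; last 3 first.
- by move=> x _; rewrite lee_fin powR_ge0.
- exact/measurable_EFinP.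
- exact: ltW.
apply: (le_trans (lee_wpmul2l (x := e'%:E) _ gm)); first by rewrite lee_fin ltW.
rewrite -EFinM lee_fin /e' -mulrA ler_piMr ?(ltW e0)//.
by rewrite mulrC ler_pdivrMr// mul1r lerDl.
Qed.

(** * Euclidean norm: comparison with coordinates, continuity, measurability *)

Section euclidean_norm.
Context {R : realType}.

Lemma enorm_ge0 n (v : 'cV[R]_n) : 0 <= enorm v.
Proof. exact: sqrtr_ge0. Qed.

Lemma enorm_sqr n (v : 'cV[R]_n) : enorm v ^+ 2 = \sum_i v i 0 ^+ 2.
Proof. by rewrite sqr_sqrtr// sumr_ge0// => i _; exact: sqr_ge0. Qed.

Lemma enorm0 n : enorm (0 : 'cV[R]_n) = 0.
Proof.
apply/eqP; rewrite -[_ == 0](sqrf_eq0 (enorm 0)) enorm_sqr big1// => i _.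
by rewrite mxE expr0n.
Qed.

Lemma enorm_distC n (u v : 'cV[R]_n) : enorm (u - v) = enorm (v - u).
Proof.
by congr Num.sqrt; apply: eq_bigr => j _; rewrite !mxE -sqrrN opprB.
Qed.

Lemma sqr_coord_le_enorm n (v : 'cV[R]_n) i : v i 0 ^+ 2 <= enorm v ^+ 2.
Proof.
rewrite enorm_sqr (bigD1 i)//= lerDl sumr_ge0// => j _; exact: sqr_ge0.
Qed.

Lemma coord_le_enorm n (v : 'cV[R]_n) i : `|v i 0| <= enorm v.
Proof.
by rewrite -(ler_pXn2r (n := 2))// ?nnegrE ?enorm_ge0// real_normK ?num_real//
  sqr_coord_le_enorm.
Qed.

Lemma enorm_continuous n : continuous (@enorm R n).
Proof.
move=> v; apply: (@continuous_comp _ _ _ (fun v : 'cV[R]_n => \sum_i v i 0 ^+ 2)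
  Num.sqrt); last exact: sqrt_continuous.
have : continuous (fun v : 'cV[R]_n => \sum_i v i 0 ^+ 2); last exact.
apply: continuous_big => // [|i _ w]; first exact: add_continuous.
apply: (@continuous_comp _ _ _ (fun v : 'cV[R]_n => v i 0) (fun x => x ^+ 2)).
  exact: coord_continuous.
exact: exprn_continuous.
Qed.

Lemma continuous_subr_cV n (c : 'cV[R]_n) :
  continuous (fun v : 'cV[R]_n => v - c).
Proof.
move=> v; apply: (cvg_mx_entryP (F := nbhs v) _ _).2 => i j; rewrite !mxE.
under eq_fun do rewrite !mxE.
apply: (@cvgB _ R^o _ _ _ (fun x : 'cV[R]_n => x i j) (fun=> c i j)).
  exact: coord_continuous.
exact: cvg_cst.
Qed.

Lemma measurable_enorm d (T : measurableType d) n (f : T -> 'cV[R]_n) :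
  (forall i, measurable_fun [set: T] (fun x => f x i 0)) ->
  measurable_fun [set: T] (fun x => enorm (f x)).
Proof.
move=> mf; rewrite /enorm.
apply: (@measurableT_comp _ _ _ _ _ _ (Num.sqrt : R -> R) _
  (fun x => \sum_i f x i 0 ^+ 2)).
  by apply: continuous_measurable_fun; exact: sqrt_continuous.
apply: (@measurable_sum _ _ _ _ _ _ (fun i x => f x i 0 ^+ 2)) => i.
exact: measurable_funX.
Qed.

Lemma measurable_coord_cV n (i : 'I_n) :
  measurable_fun [set: borel_cV R n] (fun v : borel_cV R n => v i 0).
Proof.
apply: (measurability _ (RGenOInfty.measurableE R)) => _ [_ [x ->] <-].
rewrite setTI; apply: sub_sigma_algebra.
have /continuousP := @coord_continuous R n 1 i 0; apply.
exact: interval_open.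
Qed.

End euclidean_norm.

(** * Regularity in the parameter and evaluation at random parameters *)

(** The set [D] itself may fail to be measurable. As [g] takes its values in [D], a trace [D]
    intersected with [A] has the same preimage under [g] as the measurable set [A]. *)
Lemma trace_measurable_comp d1 d2 d3 (T1 : measurableType d1)
    (T2 : measurableType d2) (T3 : measurableType d3) (D : set T2)
    (f : T2 -> T3) (g : T1 -> T2) :
  trace_measurable_fun D f -> measurable_fun [set: T1] g ->
  (forall x, D (g x)) -> measurable_fun [set: T1] (f \o g).
Proof.
move=> mf mg Dg _ B mB; rewrite setTI.
have [A mA DfA] := mf B mB.
have gD : g @^-1` D = setT by rewrite -subTset => x _; exact: Dg.
have -> : (f \o g) @^-1` B = g @^-1` (D `&` f @^-1` B).
  by rewrite preimage_setI gD setTI.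
rewrite DfA preimage_setI gD.
exact: mg.
Qed.

(** Near [a] the differential quotient is at most [1], so the increment of [f] is bounded by [G b],
    the norm of [b - a] plus the linear term, and [G] tends to [0]. *)
Lemma jacobian_on_continuous (R : realType) m n (D : set 'cV[R]_m)
    (f : 'cV[R]_m -> 'cV[R]_n) a J i :
  is_jacobian_on D f a J -> f b i 0 @[b --> within D (nbhs a)] --> f a i 0.
Proof.
move=> fJ.
pose G b := enorm (b - a) + `|(J *m (b - a)) i 0|.
have G0 : G b @[b --> within D (nbhs a)] --> 0.
  have Jc : continuous (fun v : 'cV[R]_m => (J *m v) i 0).
    rewrite (_ : (fun _ => _) = fun v : 'cV[R]_m => \sum_j J i j * v j 0);
      last by apply/funext => v; rewrite mxE.
    apply: continuous_big => [|j _ v]; first exact: add_continuous.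
    apply: (@continuousM _ _ (fun=> J i j) (fun v : 'cV[R]_m => v j 0)).
      exact: cst_continuous.
    exact: coord_continuous.
  have c1 : continuous (fun b : 'cV[R]_m => enorm (b - a)).
    move=> v; apply: (@continuous_comp _ _ _ (fun x : 'cV[R]_m => x - a)
      (@enorm R m)).
      exact: continuous_subr_cV.
    exact: enorm_continuous.
  have c2 : continuous (fun b : 'cV[R]_m => `|(J *m (b - a)) i 0|).
    move=> v; apply: (@continuous_comp _ _ _
      (fun b : 'cV[R]_m => (J *m (b - a)) i 0) (fun x : R => `|x|)).
      apply: (@continuous_comp _ _ _ (fun x : 'cV[R]_m => x - a)
        (fun x : 'cV[R]_m => (J *m x) i 0)).
        exact: continuous_subr_cV.
      exact: Jc.
    exact: norm_continuous.
  have : G b @[b --> a] --> G a.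
    exact: (cvgD (c1 a) (c2 a)).
  rewrite (_ : G a = 0); first by move=> Ga; exact: cvg_within_filter.
  by rewrite /G subrr enorm0 mulmx0 mxE normr0 addr0.
have : \forall b \near within D (nbhs a), `|f b i 0 - f a i 0| <= G b.
  have := (cvgrPdist_le _ _).1 fJ 1 ltr01 => /(_ (within_filter _ _)).
  rewrite near_withinE /dnbhs !near_withinE.
  apply: (@filterS _ (nbhs a)) => b /= + Db.
  (* The derivative concerns a punctured neighbourhood; at [b = a] the bound is trivial. *)
  have [->|ba] := eqVneq b a.
    by rewrite !subrr normr0 /G addr_ge0// enorm_ge0.
  move=> /(_ isT Db); rewrite sub0r normrN ger0_norm ?divr_ge0 ?enorm_ge0//.
  have ba0 : 0 < enorm (b - a).
    rewrite lt0r enorm_ge0 andbT; apply: contra_neq ba => ba0.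
    apply/colP => j; have := coord_le_enorm (b - a) j.
    by rewrite ba0 normr_le0 !mxE subr_eq0 => /eqP.
  rewrite ler_pdivrMr// mul1r => /(le_trans (coord_le_enorm _ i)).
  rewrite /G; move: (J *m (b - a)) => K; rewrite !mxE => le_ba.
  rewrite -[X in `|X|](subrK (K i 0)).
  by rewrite (le_trans (ler_normD _ _))// lerD2r.
move=> fG; apply/cvgrPdist_le => e e0.
have Ge := (cvgrPdist_le _ _).1 G0 e e0.
apply: filterS2 fG (Ge _) => b fG.
rewrite sub0r normrN => /(le_trans (ler_norm _)).
by rewrite distrC; exact: le_trans.
Qed.

(** The set [D] may contain no rational point. Instead, one point of [D] is picked in each ball with
    rational centre and radius [1/(k+1)] that meets [D], with [x0] as default; these balls are
    countably many. *)
Lemma separable_cV (R : realType) n (D : set 'cV[R]_n) (x0 : 'cV[R]_n) :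
  D x0 -> exists2 a : nat -> 'cV[R]_n, (forall n, D (a n)) &
    D `<=` closure (range a).
Proof.
move=> Dx0.
pose pick (qn : 'cV[rat]_n * nat) : 'cV[R]_n :=
  xget x0 (D `&` ball (map_mx ratr qn.1 : 'cV[R]_n) (qn.2.+1%:R^-1)).
exists (fun k => pick (odflt (0, 0%N) (unpickle k))).
  by move=> k; rewrite /pick; case: xgetP => [x _ []|].
move=> x Dx B /nbhs_ballP[e/= e0 eB].
(* The point [x] and the point picked in its ball are both within [1/(k+1)] of the rational centre,
   hence within [e] of each other. *)
have [k] : exists k : nat, k.+1%:R^-1 < e / 2.
  exists (Num.bound (e / 2)^-1); rewrite invf_plt ?posrE ?divr_gt0//.
  rewrite (lt_le_trans (archi_boundP _))// ?ler_nat//.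
  by rewrite invr_ge0 divr_ge0// ltW.
move=> ke.
have k0 : 0 < k.+1%:R^-1 :> R by rewrite invr_gt0.
have /choice[q xq] : forall i, exists q : rat,
    ball (ratr q : R) (k.+1%:R^-1) (x i 0).
  move=> i.
  have xk : x i 0 - k.+1%:R^-1 < x i 0 by rewrite gtrBl.
  have [q] := rat_in_itvoo xk.
  rewrite in_itv/= => /andP[q1 q2]; exists q.
  by rewrite /ball/= ltr_distl q1 (lt_trans q2)// ltrDl.
pose Q : 'cV[rat]_n := \col_i q i.
have Qx : ball (map_mx ratr Q : 'cV[R]_n) (k.+1%:R^-1) x.
  by split=> // i j; rewrite !mxE ord1; exact: xq.
exists (pick (Q, k)); split.
  by exists (pickle (Q, k)) => //; rewrite pickleK.
apply: eB; rewrite /pick; case: xgetP => /=; last first.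
  by move=> /(_ x)[].
move=> y _ [_ [_ Qy]]; case: Qx => _ Qx; split=> // i j.
have := Qx i j; have := Qy i j; rewrite /ball/= => yq xq'.
rewrite (splitr e) (le_lt_trans (ler_distD (map_mx ratr Q i j) _ _))//.
by rewrite ltrD ?(lt_trans yq)// distrC (lt_trans xq').
Qed.

(** The exceptional null set depends on the pair of parameters. A countable
    dense set of parameters yields a single one, outside of which the bound
    extends to all parameters by continuity; it can then be applied to random
    parameters. *)
Lemma ae_lipschitz (R : realType) d (Omega : measurableType d)
    (mu : {measure set Omega -> \bar R}) m n (D : set 'cV[R]_m)
    (f : Omega -> 'cV[R]_m -> 'cV[R]_n)
    (l : Omega -> R) :
  (forall w a i, D a -> f w b i 0 @[b --> within D (nbhs a)] --> f w a i 0) ->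
  (forall a b, D a -> D b ->
    {ae mu, forall w, enorm (f w b - f w a) <= l w * enorm (b - a)}) ->
  {ae mu, forall w a b i, D a -> D b ->
    `|f w b i 0 - f w a i 0| <= l w * enorm (b - a)}.
Proof.
move=> fc fl.
have [D0|] := pselect (D !=set0); last first.
  by move=> D0; apply: nearW => w a b i Da; exfalso; apply: D0; exists a.
have [x0 Dx0] := D0.
have [a Da Dcl] := separable_cV Dx0.
have H : {ae mu, forall w, forall p q i,
    `|f w (a q) i 0 - f w (a p) i 0| <= l w * enorm (a q - a p)}.
  apply/ae_foralln => p; apply/ae_foralln => q.
  apply: filterS (fl _ _ (Da p) (Da q)) => w + i; apply: le_trans.
  by have := coord_le_enorm (f w (a q) - f w (a p)) i; rewrite !mxE.
(* Extends the bound in one argument, the other being fixed. It is used twice: from two points of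
   the dense sequence to one, then, by symmetry, to none. *)
have lim1 w c b i : D c -> D b ->
  (forall q, `|f w (a q) i 0 - f w c i 0| <= l w * enorm (a q - c)) ->
    `|f w b i 0 - f w c i 0| <= l w * enorm (b - c).
  move=> Dc Db H1.
  (* As [b] is in the closure of the sequence, its neighbourhoods trace a proper filter on the
     range, along which large inequalities pass to the limit. *)
  have FF : ProperFilter (within (range a) (nbhs b)).
    exact/within_nbhs_proper/Dcl.
  apply: (@ler_cvg_to _ (within (range a) (nbhs b)) _ _
    (fun x => `|f w x i 0 - f w c i 0|) (fun x => l w * enorm (x - c))).
  - apply: cvg_norm; apply: (@cvgB _ R^o); last exact: cvg_cst.
    apply: cvg_trans (fc w b i Db).
    apply: cvg_app => A; rewrite /within/=.
    apply: (@filterS _ (nbhs b)) => x + [p _ px]; apply.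
    by rewrite -px.
  - apply: cvg_within_filter; apply: (@cvgM _ _ _ _ (fun=> l w)).
      exact: cvg_cst.
    apply: (@continuous_comp _ _ _ (fun x : 'cV[R]_m => x - c) (@enorm R m) b).
      exact: continuous_subr_cV.
    exact: enorm_continuous.
  - by rewrite near_withinE; apply: nearW => x [p _ <-].
apply: filterS H => w H c b i Dc Db.
apply: (lim1 w c b i) => // q.
by rewrite distrC enorm_distC; apply: lim1.
Qed.

(** * Scaled bounds and the truncation argument *)

Lemma scaled_abseB_le (R : realType) (t e : R) (x y : \bar R) : 0 < t ->
  (`|x - y| <= (e / t)%:E)%E -> (`|t%:E * x - t%:E * y| <= e%:E)%E.
Proof.
case: x => [x| |]; case: y => [y| |]//= t0.
rewrite !lee_fin ler_pdivlMr// => xy.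
by rewrite -mulrBr normrM gtr0_norm// mulrC.
Qed.

Lemma lee_scaled (R : realType) (t e : R) (x : \bar R) : 0 < t ->
  (t%:E * x <= e%:E)%E -> (x <= (e / t)%:E)%E.
Proof.
move=> t0; case: x => [x| |]; rewrite ?leNye//.
  by rewrite -EFinM !lee_fin ler_pdivlMr// mulrC.
by rewrite gt0_muley ?lte_fin.
Qed.

(** If [l] is at most the level [A^(1/nu)], the first term suffices. Otherwise [A] is at most
    [l^nu], so [l^4] is at most [l^(4+nu) / A], and the arithmetic-geometric inequality bounds
    [t * l^2 * n^2] by [e * t^2 * n^4 + l^4 / (4 * e)]. *)
Lemma sqr_truncation_le (R : realType) (l n t nu A e : R) :
  0 <= l -> 0 < nu -> 0 < A -> 0 < e -> 0 <= t ->
  t * (l * n) ^+ 2 <= (A `^ nu^-1) ^+ 2 * (t * n ^+ 2) +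
    (e * (t ^+ 2 * n ^+ 4) + (4 * e * A)^-1 * l `^ (4 + nu)).
Proof.
move=> l0 nu0 A0 e0 t0.
have n20 := sqr_ge0 n.
have n40 : 0 <= n ^+ 4 by rewrite (exprM n 2 2) sqr_ge0.
have c0 : 0 <= (4 * e * A)^-1 by rewrite invr_ge0 !mulr_ge0// ltW.
have p0 : 0 <= e * (t ^+ 2 * n ^+ 4).
  exact: (mulr_ge0 (ltW e0) (mulr_ge0 (sqr_ge0 t) n40)).
have [lM|Ml] := leP l (A `^ nu^-1).
  apply: ler_wpDr.
    by rewrite addr_ge0// mulr_ge0// powR_ge0.
  rewrite exprMn mulrCA; apply: ler_wpM2r; first exact: mulr_ge0.
  by rewrite lerXn2r ?nnegrE ?powR_ge0.
apply: ler_wpDl.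
  exact: (mulr_ge0 (sqr_ge0 _) (mulr_ge0 t0 n20)).
have l0' : 0 < l by apply: le_lt_trans Ml; exact: powR_ge0.
have Alnu : A <= l `^ nu.
  have -> : A = (A `^ nu^-1) `^ nu.
    by rewrite -powRrM mulVf ?gt_eqF// powRr1// ltW.
  by apply: ge0_ler_powR; rewrite ?nnegrE ?powR_ge0// ltW.
have l4 : l ^+ 4 <= A^-1 * l `^ (4 + nu).
  rewrite powRD; last by rewrite (gt_eqF l0') implybT.
  rewrite powR_mulrn// mulrCA -[leLHS]mulr1 ler_wpM2l ?exprn_ge0//.
  by rewrite ler_pdivlMl// mulr1.
apply: (@le_trans _ _ (e * (t ^+ 2 * n ^+ 4) + (4 * e)^-1 * l ^+ 4));
  last first.
  rewrite lerD2l [in leRHS]invfM -mulrA; apply: ler_wpM2l => //.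
  by rewrite invr_ge0 mulr_ge0// ltW.
rewrite -subr_ge0.
have -> : e * (t ^+ 2 * n ^+ 4) + (4 * e)^-1 * l ^+ 4 - t * (l * n) ^+ 2 =
    e^-1 * (e * (t * n ^+ 2) - l ^+ 2 / 2) ^+ 2.
  by field; rewrite gt_eqF.
by rewrite mulr_ge0 ?sqr_ge0// invr_ge0 ltW.
Qed.

(** [M] is the truncation level of [l]; [e1] is chosen first so that the term
    with [n ^+ 4] is at most [e / 3], and then [A] (hence [M]) so that the term
    with [l `^ (4 + nu)] is. *)
Lemma scaled_second_moment_cvg0 d (T : measurableType d) (R : realType)
    (mu : {measure set T -> \bar R}) (F : set_system R) {FF : Filter F}
    (l n f : R -> T -> R) (nu C K : R) :
  0 < nu ->
  (forall t, measurable_fun [set: T] (l t)) ->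
  (forall t x, 0 <= l t x) ->
  (\forall t \near F, [/\ 0 < t, measurable_fun [set: T] (n t) &
    measurable_fun [set: T] (f t)]) ->
  (\forall t \near F, {ae mu, forall x, `|f t x| <= l t x * n t x}) ->
  (\forall t \near F, (\int[mu]_x (l t x `^ (4 + nu))%:E <= K%:E)%E) ->
  (\forall t \near F,
    ((t ^+ 2)%:E * \int[mu]_x (n t x ^+ 4)%:E <= C%:E)%E) ->
  (t%:E * \int[mu]_x (n t x ^+ 2)%:E)%E @[t --> F] --> (0 : \bar R)%E ->
  forall e, 0 < e -> \forall t \near F,
    (t%:E * \int[mu]_x (f t x ^+ 2)%:E <= e%:E)%E.
Proof.
move=> nu0 ml l0 mnf fln lK nC n0 e e0.
(* [C'] and [K'] are positive upper bounds of [C] and [K], by which one may divide. *)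
pose C' := `|C| + 1.
pose K' := `|K| + 1.
have C'0 : 0 < C' by rewrite ltr_wpDl.
have K'0 : 0 < K' by rewrite ltr_wpDl.
pose e1 := e / 3 / C'.
have e10 : 0 < e1 by rewrite !divr_gt0.
(* Solves [1 / (4 * e1 * A) = e / (3 * K')]. *)
pose A := 3 * K' / (4 * e1 * e).
have A0 : 0 < A by exact: divr_gt0 (mulr_gt0 _ _) (mulr_gt0 (mulr_gt0 _ _) _).
pose M := A `^ nu^-1.
have M20 : 0 <= M ^+ 2 by exact: sqr_ge0.
have M21 : 0 < M ^+ 2 + 1 by rewrite ltr_wpDl.
have ne : \forall t \near F,
    (t%:E * \int[mu]_x (n t x ^+ 2)%:E <= (e / 3 / (M ^+ 2 + 1))%:E)%E.
  by apply: cvge_near_le n0 _; rewrite !divr_gt0.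
near=> t.
have [t0 mn mf] : [/\ 0 < t, measurable_fun [set: T] (n t) &
    measurable_fun [set: T] (f t)] by near: t.
have t0' := ltW t0.
have mn2 k : measurable_fun [set: T] (fun x => (n t x ^+ k)%:E).
  by apply/measurable_EFinP; exact: measurable_funX.
have ml4 : measurable_fun [set: T] (fun x => (l t x `^ (4 + nu))%:E).
  apply/measurable_EFinP.
  exact: (measurableT_comp (measurable_powR _) (ml t)).
have n20 x : (0 <= (n t x ^+ 2)%:E)%E by rewrite lee_fin sqr_ge0.
have n40 x : (0 <= (n t x ^+ 4)%:E)%E.
  by rewrite lee_fin (exprM _ 2 2) sqr_ge0.
have l40 x : (0 <= (l t x `^ (4 + nu))%:E)%E by rewrite lee_fin powR_ge0.
have c30 : 0 <= (4 * e1 * A)^-1.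
  by rewrite invr_ge0; exact: mulr_ge0 (mulr_ge0 _ (ltW e10)) (ltW A0).
(* Pointwise majorant of [t * f^2]; each of its three terms will have integral at most [e / 3]. *)
pose g x := ((M ^+ 2 * t)%:E * (n t x ^+ 2)%:E +
  ((e1 * t ^+ 2)%:E * (n t x ^+ 4)%:E +
   ((4 * e1 * A)^-1)%:E * (l t x `^ (4 + nu))%:E))%E.
have c1 : 0 <= M ^+ 2 * t by rewrite mulr_ge0.
have c2 : 0 <= e1 * t ^+ 2 by exact: mulr_ge0 (ltW e10) (sqr_ge0 t).
have -> : (t%:E * \int[mu]_x (f t x ^+ 2)%:E)%E =
    (\int[mu]_x (t%:E * (f t x ^+ 2)%:E))%E.
  rewrite ge0_integralZl_EFin//.
  - by move=> x _; rewrite lee_fin sqr_ge0.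
  - by apply/measurable_EFinP; exact: measurable_funX.
apply: (@le_trans _ _ (\int[mu]_x g x)%E).
  apply: ae_ge0_le_integral => //.
  - by move=> x _; rewrite mule_ge0 ?lee_fin ?sqr_ge0.
  - apply: emeasurable_funM => //.
    by apply/measurable_EFinP; exact: measurable_funX.
  - by move=> x _; rewrite /g !adde_ge0// mule_ge0// lee_fin.
  - by apply: emeasurable_funD; [|apply: emeasurable_funD];
      apply: emeasurable_funM.
  have : {ae mu, forall x, `|f t x| <= l t x * n t x} by near: t.
  apply: filterS => x fx _; rewrite /g -!EFinM -!EFinD lee_fin.
  have := sqr_truncation_le (n t x) (l0 t x) nu0 A0 e10 t0'.
  rewrite -/M (mulrA (M ^+ 2)) (mulrA e1); apply: le_trans.
  rewrite ler_wpM2l// -(real_normK (num_real (f t x))).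
  by rewrite lerXn2r ?nnegrE// (le_trans _ fx).
rewrite /g ge0_integralD//; last 4 first.
- by move=> x _; rewrite mule_ge0.
- exact: emeasurable_funM.
- by move=> x _; rewrite adde_ge0// mule_ge0.
- by apply: emeasurable_funD; exact: emeasurable_funM.
rewrite ge0_integralD//; last 4 first.
- by move=> x _; rewrite mule_ge0.
- exact: emeasurable_funM.
- by move=> x _; rewrite mule_ge0.
- exact: emeasurable_funM.
rewrite !ge0_integralZl_EFin//.
have -> : e = e / 3 + (e / 3 + e / 3) by field.
rewrite !EFinD; apply: leeD; [|apply: leeD].
- rewrite EFinM -muleA.
  have : (t%:E * \int[mu]_x (n t x ^+ 2)%:E <= (e / 3 / (M ^+ 2 + 1))%:E)%E.
    by near: t.
  move=> /(lee_wpmul2l (x := (M ^+ 2)%:E)) => /(_ M20) /le_trans; apply.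
  rewrite -EFinM lee_fin mulrCA ler_piMr ?divr_ge0 ?(ltW e0)//.
  by rewrite ler_pdivrMr// mul1r lerDl.
- rewrite EFinM -muleA.
  have : ((t ^+ 2)%:E * \int[mu]_x (n t x ^+ 4)%:E <= C%:E)%E by near: t.
  move=> /(lee_wpmul2l (x := e1%:E)) => /(_ (ltW e10)) /le_trans; apply.
  rewrite -EFinM lee_fin /e1 mulrAC ler_pdivrMr//.
  rewrite ler_wpM2l ?divr_ge0 ?(ltW e0)//.
  by rewrite (le_trans (ler_norm C))// lerDl.
- have : (\int[mu]_x (l t x `^ (4 + nu))%:E <= K%:E)%E by near: t.
  move=> /(lee_wpmul2l (x := ((4 * e1 * A)^-1)%:E)) => /(_ c30) /le_trans.
  apply; rewrite -EFinM lee_fin.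
  have -> : (4 * e1 * A)^-1 = e / 3 / K'.
    by rewrite /A; field; rewrite !gt_eqF.
  rewrite mulrAC ler_pdivrMr// ler_wpM2l ?divr_ge0 ?(ltW e0)//.
  by rewrite (le_trans (ler_norm K))// lerDl.
Unshelve. all: by end_near. Qed.

(** With [a] and [b] the two differences, the left side is [a * wj + wi * b + a * b]. Young's
    inequality puts the small weight [e] on the [w] terms, whose moments are merely bounded, and the
    large weight on the differences, whose moments are negligible. *)
Lemma cross_products_le (R : realType) (zi zj wi wj e : R) : 0 < e ->
  `|zi * zj - wi * wj| <= e * (wi ^+ 2 + wj ^+ 2) +
    ((4 * e)^-1 + 1) * ((zi - wi) ^+ 2 + (zj - wj) ^+ 2).
Proof.
move=> e0.
set a := zi - wi; set b := zj - wj.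
have -> : zi * zj - wi * wj = a * wj + wi * b + a * b by rewrite /a /b; ring.
have young x y : `|x * y| <= e * y ^+ 2 + (4 * e)^-1 * x ^+ 2.
  rewrite normrM -subr_ge0.
  rewrite -(real_normK (num_real x)) -(real_normK (num_real y)).
  rewrite (_ : _ - _ = e^-1 * (e * `|y| - `|x| / 2) ^+ 2).
    by rewrite mulr_ge0 ?sqr_ge0// invr_ge0 ltW.
  by field; rewrite gt_eqF.
have ab : `|a * b| <= a ^+ 2 + b ^+ 2.
  rewrite ler_norml; apply/andP; split; nra.
have := young a wj; have := young b wi; rewrite (mulrC b) => h1 h2.
have := ler_normD (a * wj + wi * b) (a * b).
have := ler_normD (a * wj) (wi * b).
lra.
Qed.

(** * Joint law against product law *)

(** Written against [lambda], the two integrands differ by [h] times the difference of the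
    densities, whose absolute value is [Delta_f]. Integrability under the joint law follows from
    that under the product law. *)
Lemma joint_product_integralB_le d1 d2 (T1 : measurableType d1)
    (T2 : measurableType d2) (R : realType)
    (lambda nu1 nu2 : {measure set (T1 * T2)%type -> \bar R})
    (f : {mfun (T1 * T2)%type >-> R}) (f1 : {mfun T1 >-> R})
    (f2 : {mfun T2 >-> R}) (h : T1 * T2 -> R) (c : R) :
  is_density nu1 lambda f ->
  is_density nu2 lambda (fun p => f1 p.1 * f2 p.2) ->
  measurable_fun [set: T1 * T2] h ->
  nu2.-integrable [set: T1 * T2] (EFin \o h) ->
  (\int[Delta_f_measure f f1 f2 lambda]_p `|h p|%:E <= c%:E)%E ->
  (`|\int[nu1]_p (h p)%:E - \int[nu2]_p (h p)%:E| <= c%:E)%E.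
Proof.
move=> nu1f nu2f mh ih hc.
have mf : measurable_fun [set: T1 * T2] f by [].
have mf12 : measurable_fun [set: T1 * T2] (fun p => f1 p.1 * f2 p.2).
  by apply: measurable_funM; exact: measurableT_comp.
have mEh : measurable_fun [set: T1 * T2] (EFin \o h) by exact/measurable_EFinP.
have mnh : measurable_fun [set: T1 * T2] (fun p => `|h p|%:E).
  by apply/measurable_EFinP; exact: measurableT_comp.
rewrite (integral_density mf nu1f)// (integral_density mf12 nu2f)//.
under eq_integral do rewrite -EFinM.
under [X in (_ - X)%E]eq_integral do rewrite -EFinM.
apply: (abse_integralB_le _ _ _).2.
- exact: measurable_funM.
- apply/integrableP; split; first exact/measurable_EFinP/measurable_funM.
  have /integrableP[_] := ih.
  rewrite (_ : \int[nu2]_x _ = \int[nu2]_x `|h x|%:E)%E//.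
  rewrite (integral_density mf12 nu2f)//; apply: le_lt_trans.
  rewrite le_eqVlt; apply/orP; left; apply/eqP; apply: eq_integral => p _ /=.
  by rewrite normrM -EFinM (ger0_norm (nu2f.1 p)).
- apply: le_trans hc; rewrite integral_density_measure//.
  rewrite le_eqVlt; apply/orP; left; apply/eqP; apply: eq_integral => p _ /=.
  by rewrite -mulrBr normrM -EFinM.
Qed.

(** The iterated integral becomes one over the product law. Diagonal entries are integrals of
    squares, to which Tonelli applies directly; the other entries go through Fubini. The diagonal
    case can therefore be used first, to establish the integrability that the others ask for. *)
Lemma risk_indepE (R : realType) dO dE dT (Omega : measurableType dO)
    (E : measurableType dE) (T : measurableType dT) d k
    (P : probability Omega R) (mu : probability E R) (X : {mfun Omega >-> E})
    (O : {mfun Omega >-> T}) (r : E -> 'cV[R]_d -> 'cV[R]_k)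
    (thetabar : T -> 'cV[R]_d) (est : Omega -> 'cV[R]_d)
    (theta : 'cV[R]_d) (i j : 'I_k) :
  (forall A, measurable A -> distribution P X A = mu A) ->
  (forall w, est w = thetabar (O w)) ->
  (forall i, measurable_fun [set: E * T]
     (fun p => Delta_r r thetabar theta p i 0)) ->
  i = j \/ (distribution P X \x distribution P O)%E.-integrable [set: E * T]
    (fun p => (Delta_r r thetabar theta p i 0 *
               Delta_r r thetabar theta p j 0)%:E) ->
  (risk_indep P mu r est theta i j =
   \int[distribution P X \x distribution P O]_p
     (Delta_r r thetabar theta p i 0 * Delta_r r thetabar theta p j 0)%:E)%E.
Proof.
move=> XE estE mD ij.
set g := fun p => _.
have mg : measurable_fun [set: E * T] (g : E * T -> \bar R).
  by apply/measurable_EFinP; exact: measurable_funM.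
transitivity (\int[distribution P X]_x \int[distribution P O]_y g (x, y))%E.
  rewrite /risk_indep mxE.
  transitivity (\int[mu]_x \int[distribution P O]_y g (x, y))%E; last first.
    by apply: eq_measure_integral => A mA _; exact/esym/XE.
  apply: eq_integral => x _; rewrite /expectation_mx mxE unlock.
  have mO : measurable_fun [set: Omega] O by [].
  rewrite -(integral_comp_pushforward P mO); last exact: measurable_fun_pair2.
  apply: eq_integral => w _.
  by rewrite /square_tr mxE big_ord1 mxE /g /Delta_r estE !mxE.
case: ij => [ij|ig]; last by rewrite integral12_prod_meas1.
rewrite fubini_tonelli1// => p.
by rewrite /g ij lee_fin -expr2 sqr_ge0.
Qed.

(** * Uniform bounds and cross moments *)

Lemma ereal_sup_lty_bound (I : Type) (R : realType) (A : set I)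
    (f : I -> \bar R) :
  (ereal_sup [set f t | t in A] < +oo)%E ->
  exists2 K : R, 0 <= K & forall t, A t -> (f t <= K%:E)%E.
Proof.
move=> supy; exists (Num.max 0 (fine (ereal_sup [set f t | t in A]))).
  by rewrite le_max lexx.
move=> t At.
have : (f t <= ereal_sup [set f t | t in A])%E.
  by apply: ereal_sup_ubound; exists t.
move: supy; case: ereal_sup => [s| |]//= _ /le_trans; apply.
  by rewrite lee_fin le_max lexx orbT.
by rewrite leNye.
Qed.

Lemma integrable_mul_sqr d (T : measurableType d) (R : realType)
    (mu : {measure set T -> \bar R}) (f g : T -> R) :
  measurable_fun [set: T] f -> measurable_fun [set: T] g ->
  (\int[mu]_x (f x ^+ 2)%:E < +oo)%E -> (\int[mu]_x (g x ^+ 2)%:E < +oo)%E ->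
  mu.-integrable [set: T] (EFin \o (fun x => f x * g x)).
Proof.
move=> mf mg fy gy.
have mfg : measurable_fun [set: T] (EFin \o (fun x => f x * g x)).
  by apply/measurable_EFinP; exact: measurable_funM.
have mf2 : measurable_fun [set: T] (fun x => (f x ^+ 2)%:E).
  by apply/measurable_EFinP; exact: measurable_funX.
have mg2 : measurable_fun [set: T] (fun x => (g x ^+ 2)%:E).
  by apply/measurable_EFinP; exact: measurable_funX.
have ge0 (h : T -> R) x : [set: T] x -> (0 <= (h x ^+ 2)%:E)%E.
  by rewrite lee_fin sqr_ge0.
apply/integrableP; split => //.
apply: (@le_lt_trans _ _ (\int[mu]_x ((f x ^+ 2)%:E + (g x ^+ 2)%:E))%E).
  apply: ge0_le_integral => //.
  - exact: measurableT_comp.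
  - exact: emeasurable_funD.
  - move=> x _; rewrite /= -EFinD lee_fin.
    by rewrite ler_norml; apply/andP; split; nra.
rewrite ge0_integralD//; [|exact: ge0|exact: ge0].
exact: lte_add_pinfty.
Qed.

(** Integrated form of [cross_products_le]. The free weight [eta] is to be taken small first,
    against [K1 + K2], and then [b] small against [1 / eta]. *)
Lemma cross_moments_le d (T : measurableType d) (R : realType)
    (mu : {measure set T -> \bar R}) (zi zj wi wj : T -> R)
    (t eta K1 K2 b : R) :
  0 < t -> 0 < eta ->
  measurable_fun [set: T] zi -> measurable_fun [set: T] zj ->
  measurable_fun [set: T] wi -> measurable_fun [set: T] wj ->
  (t%:E * \int[mu]_x (wi x ^+ 2)%:E <= K1%:E)%E ->
  (t%:E * \int[mu]_x (wj x ^+ 2)%:E <= K2%:E)%E ->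
  (t%:E * \int[mu]_x ((zi x - wi x) ^+ 2)%:E <= b%:E)%E ->
  (t%:E * \int[mu]_x ((zj x - wj x) ^+ 2)%:E <= b%:E)%E ->
  (`|t%:E * \int[mu]_x (zi x * zj x)%:E - t%:E * \int[mu]_x (wi x * wj x)%:E|
    <= (eta * (K1 + K2) + ((4 * eta)^-1 + 1) * (b + b))%:E)%E.
Proof.
move=> t0 eta0 mzi mzj mwi mwj wiK wjK zwi zwj.
have c0 : 0 <= (4 * eta)^-1 + 1 by rewrite addr_ge0// invr_ge0 mulr_ge0// ltW.
have mzwi : measurable_fun [set: T] (fun x => zi x - wi x).
  exact: measurable_funB.
have mzwj : measurable_fun [set: T] (fun x => zj x - wj x).
  exact: measurable_funB.
have msqr (h : T -> R) : measurable_fun [set: T] h ->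
    measurable_fun [set: T] (fun x => (h x ^+ 2)%:E).
  by move=> mh; apply/measurable_EFinP; exact: measurable_funX.
have ge0 (h : T -> R) x : [set: T] x -> (0 <= (h x ^+ 2)%:E)%E.
  by rewrite lee_fin sqr_ge0.
have lty (h : T -> R) (K : R) : (t%:E * \int[mu]_x (h x ^+ 2)%:E <= K%:E)%E ->
    (\int[mu]_x (h x ^+ 2)%:E < +oo)%E.
  by move=> /(lee_scaled t0) /le_lt_trans; apply; rewrite ltry.
apply: scaled_abseB_le => //; apply: (abse_integralB_le _ _ _).2.
- exact: measurable_funM.
- by apply: integrable_mul_sqr => //; [exact: lty wiK|exact: lty wjK].
apply: lee_scaled => //.
pose g x := (eta%:E * ((wi x ^+ 2)%:E + (wj x ^+ 2)%:E) +
  ((4 * eta)^-1 + 1)%:E *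
    (((zi x - wi x) ^+ 2)%:E + ((zj x - wj x) ^+ 2)%:E))%E.
have I2 (h1 h2 : T -> R) :
    measurable_fun [set: T] h1 -> measurable_fun [set: T] h2 ->
  (\int[mu]_x ((h1 x ^+ 2)%:E + (h2 x ^+ 2)%:E) =
   \int[mu]_x (h1 x ^+ 2)%:E + \int[mu]_x (h2 x ^+ 2)%:E)%E.
  move=> m1 m2; rewrite ge0_integralD//.
  - exact: ge0.
  - exact: msqr.
  - exact: ge0.
  - exact: msqr.
have m2 (h1 h2 : T -> R) :
    measurable_fun [set: T] h1 -> measurable_fun [set: T] h2 ->
  measurable_fun [set: T] (fun x => (h1 x ^+ 2)%:E + (h2 x ^+ 2)%:E)%E.
  by move=> m1 m2; apply: emeasurable_funD; exact: msqr.
have p2 (x y : R) : (0 <= (x ^+ 2)%:E + (y ^+ 2)%:E)%E.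
  by rewrite -EFinD lee_fin addr_ge0 ?sqr_ge0.
have t0' : (0 <= t%:E)%E by rewrite lee_fin ltW.
apply: (@le_trans _ _ (t%:E * \int[mu]_x g x)%E).
  apply: lee_wpmul2l => //.
  apply: ge0_le_integral => //.
  - apply/measurable_EFinP; apply: measurableT_comp => //.
    by apply: measurable_funB; exact: measurable_funM.
  - by apply: emeasurable_funD; apply: emeasurable_funM => //; exact: m2.
  - move=> x _; rewrite /g -!EFinD lee_fin.
    exact: cross_products_le.
rewrite /g ge0_integralD//; last 4 first.
- move=> x _; apply: mule_ge0; first by rewrite lee_fin ltW.
  exact: p2.
- by apply: emeasurable_funM => //; exact: m2.
- move=> x _; apply: mule_ge0; first by rewrite lee_fin.
  exact: p2.
- by apply: emeasurable_funM => //; exact: m2.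
rewrite ge0_integralZl_EFin ?(ltW eta0)//; last exact: m2.
rewrite ge0_integralZl_EFin//; last exact: m2.
rewrite (I2 wi wj)// (I2 (fun x => zi x - wi x) (fun x => zj x - wj x))//.
rewrite muleDr//; last first.
  rewrite ge0_adde_def// inE mule_ge0 ?lee_fin ?(ltW eta0)// adde_ge0//;
    by rewrite integral_ge0// => x _; rewrite lee_fin sqr_ge0.
have dist (h1 h2 : T -> R) :
    (t%:E * (\int[mu]_x (h1 x ^+ 2)%:E + \int[mu]_x (h2 x ^+ 2)%:E) =
     t%:E * \int[mu]_x (h1 x ^+ 2)%:E + t%:E * \int[mu]_x (h2 x ^+ 2)%:E)%E.
  rewrite muleDr// ge0_adde_def// inE;
    by rewrite integral_ge0// => x _; rewrite lee_fin sqr_ge0.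
rewrite [in leRHS]EFinD; apply: leeD.
  rewrite muleCA [leRHS]EFinM; apply: lee_wpmul2l; first by rewrite lee_fin ltW.
  by rewrite (dist wi wj) EFinD leeD.
rewrite muleCA [leRHS]EFinM; apply: lee_wpmul2l => //.
by rewrite (dist (fun x => zi x - wi x) (fun x => zj x - wj x)) EFinD leeD.
Qed.

(** * From the limit of the decoupled risk to that of the prediction risk *)

Theorem theorem3p2 (R : realType) (d k : nat)
  (time : set R) (Htime : is_time_set time)
  (Theta : set 'cV[R]_d)
  (dO dE : measure_display)
  (Omega : measurableType dO) (E : measurableType dE)
  (P : 'cV[R]_d -> probability Omega R)
  (X : R -> {mfun Omega >-> E})
  (Y : R -> Omega -> 'cV[R]_k)
  (mu : 'cV[R]_d -> probability E R)
  (Hmu : forall T theta, time T -> Theta theta ->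
    forall A, measurable A -> distribution (P theta) (X T) A = mu theta A)
  (r : E -> 'cV[R]_d -> 'cV[R]_k)
  (J : E -> 'cV[R]_d -> 'M[R]_(k, d))
  (Hr_reg : forall T theta, time T -> Theta theta ->
    is_regression_function (P theta) (X T) (Y T) (r^~ theta))
  (Hr_meas : forall i : 'I_k,
    trace_measurable_fun [set p : E * borel_cV R d | Theta p.2]
      (fun p : E * borel_cV R d => r p.1 p.2 i 0))
  (Hr_diff : forall x theta, Theta theta ->
    is_jacobian_on Theta (r x) theta (J x theta))
  (Hr_L2 : forall theta (i : 'I_k), Theta theta ->
    (fun x => r x theta i 0) \in Lfun (mu theta) 2%:E)
  (HJ_L2 : forall theta (i : 'I_k) (j : 'I_d), Theta theta ->
    (fun x => J x theta i j) \in Lfun (mu theta) 2%:E)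
  (thetabar : forall t : R, path_space time E t -> 'cV[R]_d)
  (Hthetabar_meas : forall t, time t ->
    measurable_fun [set: path_space time E t]
      (thetabar t : path_space time E t -> borel_cV R d))
  (Hthetabar_Theta : forall t, time t -> forall xi, Theta (thetabar t xi))
  (thetahat : R -> Omega -> 'cV[R]_d)
  (Hthetahat : forall t, time t ->
    forall w, thetahat t w = thetabar t (observed_path time X t w))
  (S : R -> R)
  (HS_le : forall T, time T -> time (S T) /\ S T <= T)
  (HS_equiv : S T / T @[T --> time_oo time] --> (1 : R))
  (lambda : forall T : R,
    {sigma_finite_measure set (E * path_space time E (S T))%type -> \bar R})
  (f_joint : forall T : R, 'cV[R]_d ->
    {mfun (E * path_space time E (S T))%type >-> R})
  (f_X : R -> 'cV[R]_d -> {mfun E >-> R})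
  (f_path : forall T : R, 'cV[R]_d -> {mfun path_space time E (S T) >-> R})
  (Hf_joint : forall T theta, time T -> Theta theta ->
    is_density
      (pushforward (P theta) (fun w => (X T w, observed_path time X (S T) w)))
      (lambda T) (f_joint T theta))
  (Hf_X : forall T theta x, time T -> Theta theta -> 0 <= f_X T theta x)
  (Hf_path : forall T theta xi, time T -> Theta theta ->
    0 <= f_path T theta xi)
  (Hf_prod : forall T theta, time T -> Theta theta ->
    is_density
      (distribution (P theta) (X T) \x
       distribution (P theta) (observed_path time X (S T)))%E
      (lambda T) (fun p => f_X T theta p.1 * f_path T theta p.2))
  (H1 : forall theta, Theta theta ->
    exists C : R, \forall T \near time_oo time,
      ((T ^+ 2)%:E *
       'E_(P theta)[fun w => (enorm (thetahat T w - thetahat (S T) w) ^+ 4)%R]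
         <= C%:E)%E)
  (ell : E -> R)
  (Hell_meas : measurable_fun [set: E] ell)
  (Hell_ge0 : forall x, 0 <= ell x)
  (H2 : forall T theta0 theta theta', time T ->
    Theta theta0 -> Theta theta -> Theta theta' ->
    {ae P theta0, forall w,
      enorm (r (X T w) theta' - r (X T w) theta)
        <= ell (X T w) * enorm (theta' - theta)})
  (H3 : forall theta, Theta theta ->
    exists2 nu : R, 0 < nu &
      (ereal_sup [set 'E_(P theta)[fun w => (ell (X T w) `^ (4 + nu))%R]
                 | T in time] < +oo)%E)
  (H4 : forall theta, Theta theta ->
    exists m : \bar R,
      [/\ (2%:E < m)%E,
          (ereal_sup
            [set 'N[Delta_f_measure (f_joint T theta) (f_X T theta)
                      (f_path T theta) (lambda T)]_m
                   [(fun p => (enorm (Delta_r r (thetabar (S T)) theta p))%:E)]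
            | T in time] < +oo)%E &
          ((T `^ mixing_exponent m)%:E *
             beta_bar (f_joint T theta) (f_X T theta) (f_path T theta)
               (lambda T))%E @[T --> time_oo time] --> (0 : \bar R)%E])
  (H5 : forall theta, Theta theta ->
    (T%:E *
       'E_(P theta)[fun w => (enorm (thetahat T w - thetahat (S T) w) ^+ 2)%R])%E
      @[T --> time_oo time] --> (0 : \bar R)%E)
  (Rlim : 'cV[R]_d -> 'M[R]_k)
  (H6 : forall theta, Theta theta ->
    scaled_cvg time
      (fun T => risk_indep (P theta) (mu theta) r (thetahat (S T)) theta)
      (Rlim theta) /\
    scaled_cvg time
      (fun T => risk_indep (P theta) (mu theta) r (thetahat T) theta)
      (Rlim theta)) :
  forall theta, Theta theta ->
    scaled_cvg time
      (fun T => risk (P theta) (X T) r (thetahat T) theta)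
      (Rlim theta).
Proof.
move=> theta Hth.
have FF : Filter (time_oo time) by exact: within_filter.
have inT : \forall T \near time_oo time, time T by exact: withinT.
have posT : \forall T \near time_oo time, 0 < T.
  by apply: (cvg_within time); exact: nbhs_pinfty_gt.
pose O T : {mfun Omega >-> path_space time E (S T)} :=
  observed_path time X (S T).
pose D T (p : E * path_space time E (S T)) :=
  Delta_r r (thetabar (S T)) theta p.
have thetahatE T w : time T -> thetahat (S T) w = thetabar (S T) (O T w).
  by move=> HT; apply: Hthetahat; have [] := HS_le _ HT.
have mr d' (U : measurableType d') (x : U -> E) (y : U -> borel_cV R d) i :
    measurable_fun [set: U] x -> measurable_fun [set: U] y ->
    (forall u, Theta (y u)) ->
    measurable_fun [set: U] (fun u => r (x u) (y u) i 0).
  move=> mx my yTheta.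
  apply: (trace_measurable_comp (Hr_meas i) (g := fun u => (x u, y u))) => //.
  exact: measurable_fun_pair.
have mD T i : time T ->
    measurable_fun [set: E * path_space time E (S T)] (fun p => D T p i 0).
  move=> HT; have [HST _] := HS_le _ HT.
  have -> : (fun p => D T p i 0) =
      (fun p => r p.1 (thetabar (S T) p.2) i 0 - r p.1 theta i 0).
    by apply/funext => p; rewrite /D /Delta_r !mxE.
  apply: measurable_funB.
    apply: (mr _ _ fst (fun p => thetabar (S T) p.2)) => //.
      exact: (measurableT_comp (Hthetabar_meas _ HST)).
    by move=> p; exact: Hthetabar_Theta.
  by apply: (mr _ _ fst (fun=> theta)).
have mth T i : time T ->
    measurable_fun [set: Omega] (fun w => thetahat T w i 0).
  move=> HT; under eq_fun do rewrite Hthetahat//.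
  apply: (measurableT_comp (@measurable_coord_cV R d i)).
  exact: (measurableT_comp (Hthetabar_meas _ HT)).
have mrhat T T' i : time T -> time T' ->
    measurable_fun [set: Omega] (fun w => r (X T w) (thetahat T' w) i 0).
  move=> HT HT'; under eq_fun do rewrite Hthetahat//.
  apply: (mr _ _ (X T)
    (fun w => thetabar T' (observed_path time X T' w))) => //.
    exact: (measurableT_comp (Hthetabar_meas _ HT')).
  by move=> w; exact: Hthetabar_Theta.
pose nu T := (distribution (P theta) (X T) \x distribution (P theta) (O T))%E.
have rhoE T i j : time T -> i = j \/
    (nu T).-integrable [set: _] (fun p => (D T p i 0 * D T p j 0)%:E) ->
  (risk_indep (P theta) (mu theta) r (thetahat (S T)) theta i j =
   \int[nu T]_p (D T p i 0 * D T p j 0)%:E)%E.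
  move=> HT ij; apply: (@risk_indepE _ _ _ _ _ _ _ _ _ _ _ (X T) (O T)) => //.
  - by move=> A; exact: Hmu.
  - by move=> w; exact: thetahatE.
  - by move=> i'; exact: mD.
have rho_cvg i j : (T%:E * risk_indep (P theta) (mu theta) r
    (thetahat (S T)) theta i j)%E @[T --> time_oo time] --> (Rlim theta i j)%:E.
  have [/cvg_mx_entryP/(_ i j) + _] := H6 _ Hth.
  by rewrite mxE; under eq_fun do rewrite mxE.
(* Convergence of the diagonal entries makes the second moments of the coordinates of [D] finite for
   large [T], hence their products integrable; [rhoE] then holds for all entries. *)
have D_integrable : \forall T \near time_oo time, forall i j,
    (nu T).-integrable [set: _] (EFin \o (fun p => D T p i 0 * D T p j 0)).
  have : \forall T \near time_oo time, forall i,
      (T%:E * risk_indep (P theta) (mu theta) r (thetahat (S T)) theta i i <=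
       (Rlim theta i i + 1)%:E)%E.
    apply: filter_forall => i.
    by apply: cvge_near_le (rho_cvg i i) _; rewrite ltrDl.
  move: inT posT; apply: filterS3 => T HT T0 rhole i j.
  have lty i' : (\int[nu T]_p (D T p i' 0 ^+ 2)%:E < +oo)%E.
    have := lee_scaled T0 (rhole i'); rewrite rhoE//; last by left.
    by move=> /le_lt_trans; apply; rewrite ltry.
  by apply: integrable_mul_sqr => //; exact: mD.
(* One half of [e] absorbs the [L^m] part; the other half bounds [c] times the scaled mixing
   coefficient, where [c] does not depend on [T]. *)
have small_Delta e : 0 < e -> \forall T \near time_oo time,
    (T%:E * \int[Delta_f_measure (f_joint T theta) (f_X T theta)
      (f_path T theta) (lambda T)]_p (enorm (D T p) ^+ 2)%:E <= e%:E)%E.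
  move=> e0; have [m [m2 /ereal_sup_lty_bound[K K0 NK] beta0]] := H4 _ Hth.
  have e2 : 0 < e / 2 by rewrite divr_gt0.
  have [c c0 cP] := scaled_square_integral_le m2 K0 e2.
  have c1 : 0 < c + 1 by rewrite ltr_wpDl.
  have : \forall T \near time_oo time, ((T `^ mixing_exponent m)%:E *
      beta_bar (f_joint T theta) (f_X T theta) (f_path T theta) (lambda T) <=
      (e / 2 / (c + 1))%:E)%E.
    by apply: cvge_near_le beta0 _; rewrite divr_gt0.
  move: inT posT; apply: filterS3 => T HT T0 beta_le.
  apply: le_trans
    (cP _ _ _ (fun p => enorm (D T p)) T (ltW T0) _ _ (NK T HT)) _.
  - by apply: measurable_enorm => i; exact: mD.
  - by move=> p; exact: enorm_ge0.
  rewrite [in leRHS](splitr e) EFinD leeD2l//.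
  apply: (@le_trans _ _ (c%:E * (e / 2 / (c + 1))%:E)%E).
    by apply: lee_wpmul2l => //; rewrite lee_fin.
  rewrite -EFinM lee_fin mulrCA ler_piMr ?(ltW e2)//.
  by rewrite ler_pdivrMr// mul1r lerDl.
(* Passes from the product law to the joint law of [X T] and the observed path; the error is
   controlled by [small_Delta], since a product of two coordinates is at most the squared norm. *)
have W_cvg i j : (T%:E * \int[P theta]_w
      (D T (X T w, O T w) i 0 * D T (X T w, O T w) j 0)%:E)%E
    @[T --> time_oo time] --> (Rlim theta i j)%:E.
  apply: cvg_approx_ereal (rho_cvg i j) _ => e e0.
  near=> T.
  have HT : time T by near: T.
  have T0 : 0 < T by near: T.
  have iD : (nu T).-integrable [set: _]
      (EFin \o (fun p => D T p i 0 * D T p j 0)).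
    by move: i j; near: T.
  have mDD : measurable_fun [set: E * path_space time E (S T)]
      (fun p => D T p i 0 * D T p j 0).
    by apply: measurable_funM; exact: mD.
  have mXO : measurable_fun [set: Omega] (fun w => (X T w, O T w)).
    exact: measurable_fun_pair.
  apply: scaled_abseB_le => //; rewrite rhoE//; last by right.
  rewrite (integral_comp_pushforward (P theta) mXO
    (g := fun p => (D T p i 0 * D T p j 0)%:E)); last exact/measurable_EFinP.
  apply: (joint_product_integralB_le (Hf_joint _ _ HT Hth)
    (Hf_prod _ _ HT Hth)) => //.
  have : (T%:E * \int[Delta_f_measure (f_joint T theta) (f_X T theta)
      (f_path T theta) (lambda T)]_p (enorm (D T p) ^+ 2)%:E <= e%:E)%E.
    by near: T; exact: small_Delta.
  move=> /(lee_scaled T0); apply: le_trans; apply: ge0_le_integral => //.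
  - by apply/measurable_EFinP; exact: measurableT_comp.
  - apply/measurable_EFinP; apply: measurable_funX.
    by apply: measurable_enorm => i'; exact: mD.
  - move=> p _; rewrite lee_fin normrM expr2.
    by apply: ler_pM => //; exact: coord_le_enorm.
(* The assumed Lipschitz bound has a null set for each pair of fixed parameters, whereas both
   estimators are random; [ae_lipschitz] provides a common null set. *)
have lip T : time T -> {ae P theta, forall w i,
    `|r (X T w) (thetahat T w) i 0 - r (X T w) (thetahat (S T) w) i 0| <=
    ell (X T w) * enorm (thetahat T w - thetahat (S T) w)}.
  move=> HT; have [HST _] := HS_le _ HT.
  have := @ae_lipschitz _ _ _ (P theta) _ _ Theta (fun w => r (X T w))
    (ell \o X T)
    (fun w a i Da => jacobian_on_continuous (Hr_diff (X T w) _ Da) (i := i))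
    (fun a b Da Db => H2 _ _ _ _ HT Hth Da Db).
  apply: filterS => w + i; apply; rewrite Hthetahat//; exact: Hthetabar_Theta.
have small_diff i e : 0 < e -> \forall T \near time_oo time,
    (T%:E * \int[P theta]_w ((r (X T w) (thetahat T w) i 0 -
       r (X T w) (thetahat (S T) w) i 0) ^+ 2)%:E <= e%:E)%E.
  have [nu' nu0 /ereal_sup_lty_bound[K _ ellK]] := H3 _ Hth.
  have [C HC] := H1 _ Hth.
  apply: (@scaled_second_moment_cvg0 _ _ _ (P theta) _ _
    (fun T w => ell (X T w))
    (fun T w => enorm (thetahat T w - thetahat (S T) w))
    (fun T w =>
       r (X T w) (thetahat T w) i 0 - r (X T w) (thetahat (S T) w) i 0)
    nu' C K) => //.
  - by move=> T; exact: measurableT_comp.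
  - move: inT posT; apply: filterS2 => T HT T0; have [HST _] := HS_le _ HT.
    split => //; last by apply: measurable_funB; exact: mrhat.
    apply: measurable_enorm => i'; under eq_fun do rewrite !mxE.
    by apply: measurable_funB; exact: mth.
  - by move: inT; apply: filterS => T HT; apply: filterS (lip T HT) => w; apply.
  - by move: inT; apply: filterS => T /ellK; rewrite unlock.
  - by move: HC; apply: filterS => T; rewrite unlock.
  - by have := H5 _ Hth; under eq_fun do rewrite unlock.
apply/cvg_mx_entryP => i j; rewrite mxE.
apply: cvg_approx_ereal (W_cvg i j) _ => e e0.
(* [K] is the sum of the two bounds in [Wle]. The choices give [eta * K = e / 2] and
   [c * (b + b) = e / 2], so the bound of [cross_moments_le] is exactly [e]. *)
pose K := `|Rlim theta i i| + `|Rlim theta j j| + 2.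
have K0 : 0 < K by rewrite ltr_wpDl// addr_ge0.
pose eta := e / 2 / K.
have eta0 : 0 < eta by rewrite !divr_gt0.
pose c := (4 * eta)^-1 + 1.
have c0 : 0 < c by rewrite ltr_wpDl// invr_ge0 mulr_ge0// ltW.
pose b := e / 4 / c.
have b0 : 0 < b by rewrite !divr_gt0.
have Wle i' : \forall T \near time_oo time, (T%:E * \int[P theta]_w
    ((r (X T w) (thetahat (S T) w) i' 0 - r (X T w) theta i' 0) ^+ 2)%:E <=
    (`|Rlim theta i' i'| + 1)%:E)%E.
  have /cvge_near_le := W_cvg i' i'.
  move=> /(_ (`|Rlim theta i' i'| + 1)) => /(_ (ltr_pwDr ltr01 (ler_norm _))).
  move: inT; apply: filterS2 => T HT.
  congr (_ * _ <= _)%E; apply: eq_integral => w _.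
  by rewrite -expr2 /D /Delta_r !mxE thetahatE.
near=> T.
have HT : time T by near: T.
have T0 : 0 < T by near: T.
have [HST _] := HS_le _ HT.
have vi : (T%:E * \int[P theta]_w
    ((r (X T w) (thetahat (S T) w) i 0 - r (X T w) theta i 0) ^+ 2)%:E <=
    (`|Rlim theta i i| + 1)%:E)%E.
  by near: T; exact: Wle.
have vj : (T%:E * \int[P theta]_w
    ((r (X T w) (thetahat (S T) w) j 0 - r (X T w) theta j 0) ^+ 2)%:E <=
    (`|Rlim theta j j| + 1)%:E)%E.
  by near: T; exact: Wle.
have mrth i' : measurable_fun [set: Omega] (fun w => r (X T w) theta i' 0).
  exact: (mr _ _ (X T) (fun=> theta)).
have -> : e = eta * ((`|Rlim theta i i| + 1) + (`|Rlim theta j j| + 1)) +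
    c * (b + b).
  by rewrite /b /eta /K; field; rewrite !gt_eqF.
rewrite mxE /risk /expectation_mx mxE unlock.
(* [z] and [v] are the coordinates of the errors with the full and with the shortened observation;
   the bounds of [small_diff] apply to [z - v], in which [r (X T w) theta] cancels. *)
pose z i' w := r (X T w) (thetahat T w) i' 0 - r (X T w) theta i' 0.
pose v i' w := r (X T w) (thetahat (S T) w) i' 0 - r (X T w) theta i' 0.
have -> : (\int[P theta]_w
    (square_tr (r (X T w) (thetahat T w) - r (X T w) theta) i j)%:E =
  \int[P theta]_w (z i w * z j w)%:E)%E.
  by apply: eq_integral => w _; rewrite /square_tr mxE big_ord1 !mxE.
have -> : (\int[P theta]_w
    (D T (X T w, O T w) i 0 * D T (X T w, O T w) j 0)%:E =
  \int[P theta]_w (v i w * v j w)%:E)%E.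
  by apply: eq_integral => w _; rewrite /D /Delta_r !mxE /= -thetahatE.
have mz i' : measurable_fun [set: Omega] (z i').
  by apply: measurable_funB => //; exact: mrhat.
have mv i' : measurable_fun [set: Omega] (v i').
  by apply: measurable_funB => //; exact: mrhat.
have zv i' : (T%:E * \int[P theta]_w ((r (X T w) (thetahat T w) i' 0 -
    r (X T w) (thetahat (S T) w) i' 0) ^+ 2)%:E <= b%:E)%E ->
  (T%:E * \int[P theta]_w ((z i' w - v i' w) ^+ 2)%:E <= b%:E)%E.
  congr (_ * _ <= _)%E; apply: eq_integral => w _.
  by rewrite /z /v opprB addrA subrK.
apply: cross_moments_le => //.
- by apply: zv; near: T; exact: small_diff.
- by apply: zv; near: T; exact: small_diff.
Unshelve. all: by end_near. Qed.
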